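(* Let $W$ be a finite Coxeter group. Every element $f$ of the biHecke monoid $M(W)$ preserves Bruhat order: for all $u,v\in W$, $u\le_Bv$ implies $u.f\le_Bv.f$.
   Context: $W=\langle s_i\mid i\in I\rangle$ is a finite Coxeter group with length $\ell$; $D_R(w)=\{i\in I:\ell(ws_i)<\ell(w)\}$; $\le_B$ denotes Bruhat order on $W$. The biHecke monoid $M(W)$ is the monoid of functions $W\to W$ (acting on the right) generated by all $\pi_i,\overline\pi_i$, $i\in I$, where $w.\pi_i=w$ if $i\in D_R(w)$ and $ws_i$ otherwise, and $w.\overline\pi_i=ws_i$ if $i\in D_R(w)$ and $w$ otherwise. *)

(* Defs.v *)
From mathcomp Require Import all_boot all_fingroup.

Set Implicit Arguments.
Unset Strict Implicit.
Unset Printing Implicit Defensive.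

Local Open Scope group_scope.

(* A Coxeter system on the finite group W: W has the presentation
   < s_i | (s_i s_j) ^ m_ij = 1 > for a Coxeter matrix m. The value m_ij = 0
   encodes infinity, since the relation x ^+ 0 = 1 is void.
   The presentation is expressed by its universal property among all groups,
   finite or not. *)
Record coxeterSystem (W : finGroupType) (I : finType) := CoxeterSystem {
  cox_gen :> I -> W;
  cox_mat : I -> I -> nat;
  cox_mat_sym : forall i j, cox_mat i j = cox_mat j i;
  cox_mat_eq1 : forall i j, (cox_mat i j == 1%N) = (i == j);
  cox_generated : <<[set cox_gen i | i : I]>> = [set: W];
  cox_rel : forall i j, (cox_gen i * cox_gen j) ^+ cox_mat i j = 1;
  cox_univ : forall (H : groupType) (f : I -> H),
    (forall i j, (f i * f j) ^+ cox_mat i j = 1) ->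
    exists phi : {multiplicative W -> H}, forall i, phi (cox_gen i) = f i
}.

Section CoxeterGroup.

Variables (W : finGroupType) (I : finType) (s : coxeterSystem W I).

Definition word_prod (t : seq I) : W := \prod_(i <- t) s i.

Lemma word_exists (w : W) :
  exists n, [exists t : n.-tuple I, word_prod t == w].
Proof.
have: w \in <<[set s i | i : I]>> by rewrite cox_generated inE.
case/gen_prodgP=> n [c cP ->].
have pick k : {i : I | c k = s i}.
  have /existsP/sigW[i /eqP ci] : [exists i, c k == s i].
    by have /imsetP[i _ ci] := cP k; apply/existsP; exists i; rewrite ci.
  by exists i.
exists n; apply/existsP; exists [tuple sval (pick k) | k < n]; apply/eqP.
by rewrite /word_prod big_tuple; apply: eq_bigr => k _;
  rewrite tnth_mktuple; case: (pick k).
Qed.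

Definition length (w : W) : nat := ex_minn (word_exists w).

Definition reduced (t : seq I) : bool := size t == length (word_prod t).

Definition right_descents (w : W) : {set I} :=
  [set i | length (w * s i) < length w].

(* Bruhat order by subexpressions: some reduced expression of v has a
   (not necessarily contiguous) subword which is a reduced expression of u. *)
Definition bruhat_le (u v : W) : Prop :=
  exists tu tv : seq I,
    [/\ reduced tu, word_prod tu = u,
        reduced tv, word_prod tv = v & subseq tu tv].

Definition bihecke_pi (i : I) : {ffun W -> W} :=
  [ffun w => if i \in right_descents w then w else w * s i].

Definition bihecke_pibar (i : I) : {ffun W -> W} :=
  [ffun w => if i \in right_descents w then w * s i else w].

(* The submonoid of functions W -> W generated by the pi_i and pibar_i;
   w.f is written f w, and w.(f g) = (w.f).g since functions act on the
   right. *)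
Inductive biHecke : {ffun W -> W} -> Prop :=
| biHecke_one : biHecke [ffun w => w]
| biHecke_pi i : biHecke (bihecke_pi i)
| biHecke_pibar i : biHecke (bihecke_pibar i)
| biHecke_mul f g : biHecke f -> biHecke g -> biHecke [ffun w => g (f w)].

End CoxeterGroup.

(* Main.v *)
(** The permutations (t, e) |-> (s_i t s_i, e + [t = s_i]) of W x {0, 1}
    satisfy the Coxeter relations, so W acts on W x {0, 1}. The resulting
    cocycle detects whether a reflection t shortens w, and a word of w exhibits
    a letter whose deletion yields t w: this is the strong exchange condition.
    It implies that, if x < y are joined by a reflection and y <> x s_i, then
    also x s_i < y s_i. Hence pi_i and pibar_i preserve the order generated by
    length-increasing multiplication by reflections. By strong exchange again,
    this order is the Bruhat order defined by subwords. *)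
Require Import Defs.
From mathcomp Require Import all_boot all_fingroup.

Set Implicit Arguments.
Unset Strict Implicit.
Unset Printing Implicit Defensive.

Section CoxeterTheory.

Local Open Scope group_scope.

Variables (W : finGroupType) (I : finType) (s : coxeterSystem W I).

Implicit Types (i j : I) (t u v w x y : W) (a b : seq I).

(** * Words in the generators and length *)

Lemma cox_genK i : s i * s i = 1.
Proof.
have /eqP m1 : cox_mat s i i == 1%N by rewrite cox_mat_eq1.
by have := cox_rel s i i; rewrite m1 expg1.
Qed.

Lemma cox_genV i : (s i)^-1 = s i.
Proof. by apply/eqP; rewrite eq_invg_mul cox_genK. Qed.

Lemma mulg_genK w i : w * s i * s i = w.
Proof. by rewrite -mulgA cox_genK mulg1. Qed.

Lemma word_prod_nil : word_prod s [::] = 1.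
Proof. by rewrite /word_prod big_nil. Qed.

Lemma word_prod_cons i a : word_prod s (i :: a) = s i * word_prod s a.
Proof. by rewrite /word_prod big_cons. Qed.

Lemma word_prod_cat a b :
  word_prod s (a ++ b) = word_prod s a * word_prod s b.
Proof. by rewrite /word_prod big_cat. Qed.

Lemma word_prod_rcons a i : word_prod s (rcons a i) = word_prod s a * s i.
Proof. by rewrite -cats1 word_prod_cat word_prod_cons word_prod_nil mulg1. Qed.

Lemma length_word_prod a : length s (word_prod s a) <= size a.
Proof.
rewrite /length; case: ex_minnP => n _; apply.
by apply/existsP; exists (in_tuple a).
Qed.

Lemma reduced_word_exists w : exists2 a, reduced s a & word_prod s a = w.
Proof.
have [a Ea sa] : exists2 a, word_prod s a = w & size a = length s w.
  rewrite /length; case: ex_minnP => n /existsP[a /eqP Ea] _.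
  by exists a; rewrite ?size_tuple.
by exists a; rewrite // /reduced Ea sa.
Qed.

Lemma length_mulgen w i : length s (w * s i) <= (length s w).+1.
Proof.
have [a /eqP ra Ea] := reduced_word_exists w.
by rewrite -Ea -word_prod_rcons -ra -(size_rcons a i) length_word_prod.
Qed.

(** * The action on [W * bool] and its cocycle *)

Definition toggle i (p : W * bool) := (p.1 ^ s i, p.2 (+) (p.1 == s i)).

Lemma toggleK i : involutive (toggle i).
Proof.
case=> t e; rewrite /toggle /= -conjgM cox_genK conjg1.
by rewrite -(inj_eq (conjg_inj (s i)) t) (conjgE (s i)) mulKg addbK.
Qed.

Definition toggle_perm i := perm (inv_inj (toggleK i)).

Lemma toggle_permE i p : toggle_perm i p = toggle i p.
Proof. by rewrite permE. Qed.

(* The two bits contributed by the k-th factor compare [t * s i] with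
   the powers of exponents 2k and 2k+1 of [s i * s j]. *)
Lemma toggle_perm_expE i j k t e :
  ((toggle_perm i * toggle_perm j) ^+ k) (t, e) =
  (t ^ (s i * s j) ^+ k,
   e (+) \big[addb/false]_(0 <= n < k.*2) (t * s i == (s i * s j) ^+ n)).
Proof.
set r := s i * s j.
(* Conjugation by [s i] inverts the rotation [r]; this turns each comparison of a conjugate of [t]
   with a generator into one of [t * s i] with a power of [r]. *)
have rJ n : s i * (r ^+ n)^-1 = r ^+ n * s i.
  have rV : r^-1 ^ s i = r.
    by rewrite conjgE /r invMg !cox_genV -!mulgA cox_genK mulg1.
  by rewrite -expgVn -{2}rV -conjXg conjgE cox_genV -mulgA mulg_genK.
have conj_eq g h : (t ^ g == h) = (t == g * h * g^-1).
  rewrite -(inj_eq (conjg_inj g^-1)) -conjgM mulgV conjg1.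
  by rewrite conjgE invgK mulgA.
have shift g : (t * s i == g) = (t == g * s i).
  by rewrite -(inj_eq (mulIg (s i))) mulg_genK.
elim: k => [|k IHk]; first by rewrite !expg0 perm1 conjg1 big_geq // addbF.
rewrite expgSr permM IHk permM !toggle_permE /toggle /= -!conjgM -!addbA.
rewrite doubleS !big_nat_recr //= -/r -expgSr -[in RHS]addbA.
congr (_, _ (+) (_ (+) (_ (+) _))); rewrite conj_eq shift; congr (t == _).
  by rewrite -mulgA rJ mulgA -expgD addnn.
rewrite invMg cox_genV -!mulgA rJ !mulgA -(mulgA _ (s i)) -/r -expgSr.
by rewrite -expgD addSn addnn.
Qed.

(** Since [(s i * s j) ^+ m = 1], the sum over [2m] exponents consists of two equal halves, which
    cancel modulo 2. *)
Lemma toggle_perm_rel i j :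
  (toggle_perm i * toggle_perm j) ^+ cox_mat s i j = 1.
Proof.
apply/permP=> -[t e]; rewrite toggle_perm_expE cox_rel conjg1 perm1.
set m := cox_mat s i j; have rm : (s i * s j) ^+ m = 1 by apply: cox_rel.
rewrite -addnn (big_cat_nat _ (n := m)) ?leq_addr //=.
rewrite -[X in index_iota X (m + m)]add0n big_addn addnK.
under [X in _ (+) (_ (+) X)]eq_bigr => n _ do rewrite expgD rm mulg1.
by rewrite addbb addbF.
Qed.

(** The universal property turns the [toggle_perm i] into an action of [W]; [eta w t] is the bit
    that [w] adds over [t]. Along a word of [w] it is the parity of the number of letters that equal
    [t] conjugated by the preceding prefix. *)
Lemma reflection_cocycle_exists :
  exists eta : W -> W -> bool,
    (forall i t, eta (s i) t = (t == s i)) /\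
    (forall u v t, eta (u * v) t = eta u t (+) eta v (t ^ u)).
Proof.
have [phi phiE] := cox_univ toggle_perm_rel.
have phi1 : phi 1 = 1 by apply: (mulgI (phi 1)); rewrite -gmulfM !mulg1.
have phiP w t e : phi w (t, e) = (t ^ w, e (+) (phi w (t, false)).2).
  have [a _ <-] := reduced_word_exists w; elim: a t e => [|i a IHa] t e.
    by rewrite word_prod_nil phi1 !perm1 conjg1 addbF.
  rewrite word_prod_cons gmulfM phiE !permM !toggle_permE /toggle /=.
  by rewrite IHa [in RHS]IHa conjgM addbA.
exists (fun w t => (phi w (t, false)).2); split=> [i t|u v t].
  by rewrite phiE toggle_permE.
by rewrite gmulfM permM phiP [LHS]/= phiP.
Qed.

(** * Reflections and strong exchange *)

Definition reflection t := [exists p : W * I, t == s p.2 ^ p.1].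

Lemma reflection_gen i x : reflection (s i ^ x).
Proof. by apply/existsP; exists (x, i). Qed.

Lemma reflectionK t x : reflection t -> t * (t * x) = x.
Proof.
case/existsP=> -[y i] /eqP -> /=.
by rewrite mulgA -conjMg cox_genK conj1g mul1g.
Qed.

Lemma strong_exchange t a : reflection t ->
    length s (t * word_prod s a) <= length s (word_prod s a) ->
  exists a1 i a2, a = a1 ++ i :: a2 /\ word_prod s (a1 ++ a2) = t * word_prod s a.
Proof.
have [eta [eta_gen etaM]] := reflection_cocycle_exists.
(* A nonzero bit must come from some letter; deleting that letter multiplies the product by [t'] on
   the left. *)
have deletion t' b : eta (word_prod s b) t' ->
  exists b1 i b2, b = b1 ++ i :: b2 /\ word_prod s (b1 ++ b2) = t' * word_prod s b.
  elim: b t' => [|i b IHb] t'.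
    rewrite word_prod_nil; suff -> : eta 1 t' = false by [].
    by have := etaM 1 1 t'; rewrite mulg1 conjg1 addbb.
  rewrite word_prod_cons etaM eta_gen; have [-> _|_ /=] := eqVneq t' (s i).
    by exists [::], i, b; rewrite mulgA cox_genK mul1g.
  case/IHb=> b1 [j [b2 [-> Eb]]]; exists (i :: b1), j, b2; split=> //.
  by rewrite cat_cons word_prod_cons Eb conjgE !mulgA mulgV mul1g.
have eta_lt t' w : eta w t' -> length s (t' * w) < length s w.
  have [b /eqP rb <-] := reduced_word_exists w.
  case/deletion=> b1 [i [b2 [Eb <-]]].
  by rewrite -rb Eb size_cat /= addnS ltnS -size_cat length_word_prod.
move=> rt le_ta; apply: deletion; apply: contraLR le_ta => eta_a.
(* For [t = s i ^ x] the contributions of [x^-1] and [x] cancel, leaving the bit of [s i]. *)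
have eta_t : eta t t.
  have [[x i] /eqP/= ->] := existsP rt.
  have etaV : eta x^-1 (s i ^ x) = eta x (s i).
    apply: (@addIb (eta x (s i))); rewrite addbb.
    have := etaM x^-1 x (s i ^ x); rewrite mulVg conjgK => <-.
    by have := etaM 1 1 (s i ^ x); rewrite mulg1 conjg1 addbb => ->.
  rewrite {1}conjgE !etaM etaV conjgK eta_gen eqxx.
  by rewrite [s i ^ s i]conjgE mulKg addbCA addbb.
(* If [t] has bit 0 on a word, it has bit 1 on [t] times that word, so it shortens the latter. *)
have := eta_lt t (t * word_prod s a); rewrite reflectionK // -ltnNge; apply.
by rewrite etaM eta_t conjgE mulKg.
Qed.

(** With equal lengths, strong exchange would express [t * w] by a word one letter shorter than its
    length. *)
Lemma length_reflection_neq t w :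
  reflection t -> length s (t * w) != length s w.
Proof.
move=> rt; have [a /eqP ra Ea] := reduced_word_exists w.
apply/eqP=> eq_len; have := strong_exchange (a := a) rt.
rewrite Ea eq_len leqnn => /(_ isT)[a1 [i [a2 [Ea12 Etw]]]].
have := length_word_prod (a1 ++ a2); rewrite Etw eq_len -Ea -ra Ea12.
by rewrite !size_cat /= addnS ltnn.
Qed.

(** * Bruhat steps and right multiplication by generators *)

Lemma mulg_genE w i : w * s i = (s i ^ w^-1) * w.
Proof. by rewrite conjgE invgK mulgA mulgKV. Qed.

(** The edges of the Bruhat graph; [connect bruhat_step] is the working form of Bruhat order. *)
Definition bruhat_step : rel W :=
  [rel x y | reflection (y * x^-1) && (length s x < length s y)].

Lemma bruhat_step_gen w i :
  bruhat_step w (w * s i) = (length s w < length s (w * s i)).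
Proof.
by rewrite /bruhat_step /= {1}mulg_genE mulgK reflection_gen.
Qed.

(** If the step is not kept, strong exchange deletes a letter from [rcons a i], with [a] a reduced
    word of [x], to get [y * s i]. Deleting the last letter gives [y = x * s i]; deleting an earlier
    one makes [y] shorter than [x]. *)
Lemma bruhat_step_mulgen x y i :
  bruhat_step x y -> y = x * s i \/ bruhat_step (x * s i) (y * s i).
Proof.
case/andP=> rt lt_xy; set t := y * x^-1 in rt.
have Ey : y = t * x by rewrite mulgKV.
rewrite /bruhat_step /= invMg mulgA -[y * s i * _]mulgA mulgV mulg1 -/t rt /=.
case: ltnP => [_|le_ys]; [by right | left].
have [a /eqP ra Ea] := reduced_word_exists x.
have := strong_exchange (a := rcons a i) rt.
rewrite word_prod_rcons Ea mulgA -Ey => /(_ le_ys)[a1 [j [a2 [Eai Eys]]]].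
case/lastP: a2 => [|a2 j'] in Eai Eys *.
  move: Eai; rewrite cats1 cats0 in Eys * => /rcons_inj[Ea1 _].
  by rewrite -Ea Ea1 Eys mulg_genK.
move: Eai; rewrite -cat_rcons -rcons_cat => /rcons_inj[Ea12 Ej].
move: Eys; rewrite -rcons_cat -Ej word_prod_rcons => /mulIg Ey12.
have := length_word_prod (a1 ++ a2); rewrite Ey12 leqNgt.
by rewrite (leq_trans _ lt_xy) // -Ea -ra Ea12 !size_cat size_rcons addSn ltnS.
Qed.

Lemma bruhat_step_ascent w i :
  i \notin right_descents s w -> bruhat_step w (w * s i).
Proof.
rewrite inE -leqNgt leq_eqVlt bruhat_step_gen => /predU1P[Ew|//].
have := length_reflection_neq w (reflection_gen i w^-1).
by rewrite -mulg_genE Ew eqxx.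
Qed.

Lemma bruhat_step_descent w i :
  i \in right_descents s w -> bruhat_step (w * s i) w.
Proof.
by rewrite inE -{2 4}(mulg_genK w i) bruhat_step_gen mulg_genK.
Qed.

(** * Monotonicity of the biHecke monoid *)

Lemma connect_homo (f : W -> W) :
    (forall x y, bruhat_step x y -> connect bruhat_step (f x) (f y)) ->
  forall x y, connect bruhat_step x y -> connect bruhat_step (f x) (f y).
Proof.
move=> fP x y /connectP[p pP ->]; elim: p x pP => [|z p IHp] x /=.
  by rewrite connect0.
by case/andP=> /fP xz /IHp; apply: connect_trans.
Qed.

Lemma bihecke_pi_homo i x y : connect bruhat_step x y ->
  connect bruhat_step (bihecke_pi s i x) (bihecke_pi s i y).
Proof.
apply: connect_homo => {}x {}y xy; have cxy := connect1 xy.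
rewrite !ffunE; case: ifPn => [_|ix]; case: ifPn => [iy|iy] //.
- exact: connect_trans cxy (connect1 (bruhat_step_ascent iy)).
- have [->|xyi] := bruhat_step_mulgen i xy; first exact: connect0.
  exact: connect_trans (connect1 xyi) (connect1 (bruhat_step_descent iy)).
(* The exception [y = x * s i] would make [i] a descent of [y]. *)
have [Ey|/connect1//] := bruhat_step_mulgen i xy.
have /andP[_] := xy.
have /andP[_] := bruhat_step_ascent iy.
by rewrite Ey mulg_genK => lt1 /(ltn_trans lt1); rewrite ltnn.
Qed.

Lemma bihecke_pibar_homo i x y : connect bruhat_step x y ->
  connect bruhat_step (bihecke_pibar s i x) (bihecke_pibar s i y).
Proof.
apply: connect_homo => {}x {}y xy; have cxy := connect1 xy.
rewrite !ffunE; case: ifPn => [ix|ix]; case: ifPn => [iy|iy] //.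
(* Here the exception [y = x * s i] contradicts that [i] is a descent of [x]. *)
- have [Ey|/connect1//] := bruhat_step_mulgen i xy.
  have /andP[_] := xy; have /andP[_] := bruhat_step_descent ix.
  by rewrite Ey => lt1 /(ltn_trans lt1); rewrite ltnn.
- exact: connect_trans (connect1 (bruhat_step_descent ix)) cxy.
have [->|xyi] := bruhat_step_mulgen i xy; first by rewrite mulg_genK.
exact: connect_trans (connect1 (bruhat_step_ascent ix)) (connect1 xyi).
Qed.

Lemma biHecke_homo f x y : biHecke s f ->
  connect bruhat_step x y -> connect bruhat_step (f x) (f y).
Proof.
move=> Hf; elim: Hf x y => [|i|i|f' g _ IHf _ IHg] x y xy.
- by rewrite !ffunE.
- exact: bihecke_pi_homo.
- exact: bihecke_pibar_homo.
by rewrite !ffunE; apply/IHg/IHf.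
Qed.

(** * Comparison with the subword order *)

Lemma reduced_rconsl a i : reduced s (rcons a i) ->
  reduced s a /\ i \notin right_descents s (word_prod s a).
Proof.
rewrite /reduced size_rcons word_prod_rcons inE => /eqP ra.
have la := length_word_prod a.
have := length_mulgen (word_prod s a) i; rewrite -ra ltnS => le_a.
by rewrite -leqNgt ltnW ?andbT ?ltnS // eqn_leq le_a la.
Qed.

Lemma subword_connect a b : reduced s a -> subseq b a ->
  connect bruhat_step (word_prod s b) (word_prod s a).
Proof.
elim/last_ind: a b => [|a i IHa] b ra.
  by rewrite subseq0 => /eqP->; apply: connect0.
have {ra}[ra ia] := reduced_rconsl ra.
rewrite word_prod_rcons; have step_ai := connect1 (bruhat_step_ascent ia).
case/lastP: b => [|b j] sub_ba.
  exact: connect_trans (IHa _ ra (sub0seq _)) step_ai.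
move: sub_ba; rewrite -subseq_rev !rev_rcons /=.
case: eqP => [->|_] sub_ba; last first.
  rewrite -rev_rcons subseq_rev in sub_ba.
  exact: connect_trans (IHa _ ra sub_ba) step_ai.
rewrite subseq_rev in sub_ba.
(* When both words end in [i], monotonicity of [bihecke_pi] lifts the comparison of the prefixes: it
   sends the larger prefix to the full product, and the smaller one to an element above its product
   with [s i]. *)
have := bihecke_pi_homo i (IHa _ ra sub_ba); rewrite !ffunE (negPf ia).
rewrite word_prod_rcons; case: ifPn => // /bruhat_step_descent/connect1.
exact: connect_trans.
Qed.

(** If appending [i] to the reduced [b] breaks reducedness, strong exchange absorbs [s i] by
    deleting a letter of [b]. *)
Lemma reduced_subword a :
  exists b, [/\ reduced s b, word_prod s b = word_prod s a & subseq b a].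
Proof.
elim/last_ind: a => [|a i [b [rb Eb sub_ba]]].
  by exists [::]; rewrite /reduced eq_sym -leqn0 length_word_prod.
have [rbi|nrbi] := boolP (reduced s (rcons b i)).
  exists (rcons b i); rewrite !word_prod_rcons Eb; split=> //.
  by rewrite -!cats1 cat_subseq.
have le_bi : length s (word_prod s b * s i) <= length s (word_prod s b).
  rewrite -(eqP rb) -ltnS -(size_rcons b i) ltn_neqAle -word_prod_rcons.
  by rewrite eq_sym nrbi length_word_prod.
have := strong_exchange (a := b) (reflection_gen i (word_prod s b)^-1).
rewrite -mulg_genE => /(_ le_bi)[b1 [j [b2 [Eb12 Eprod]]]].
exists (b1 ++ b2); rewrite Eprod word_prod_rcons Eb; split=> //.
  rewrite /reduced eqn_leq length_word_prod andbT Eprod -ltnS.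
  apply: leq_trans (length_mulgen _ i); rewrite mulg_genK -(eqP rb) Eb12.
  by rewrite !size_cat /= addnS.
apply: subseq_trans (subseq_rcons a i); apply: subseq_trans sub_ba.
by rewrite Eb12 cat_subseq // subseq_cons.
Qed.

(** Descending the chain from the top, each step deletes one letter by strong exchange; the
    resulting words may be nonreduced. *)
Lemma connect_subword u a : connect bruhat_step u (word_prod s a) ->
  exists2 b, subseq b a & word_prod s b = u.
Proof.
case/connectP=> p; elim: p u => [|z p IHp] u /=; first by exists a.
case/andP=> /andP[rt lt_uz] /IHp/[apply] -[b sub_ba Eb].
have Eu : (z * u^-1) * z = u by rewrite -[X in _ * X = _](mulgKV u) reflectionK.
have := strong_exchange (a := b) rt; rewrite Eb Eu => /(_ (ltnW lt_uz)).
case=> b1 [i [b2 [Eb12 Eprod]]]; exists (b1 ++ b2) => //.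
by apply: subseq_trans sub_ba; rewrite Eb12 cat_subseq // subseq_cons.
Qed.

Lemma bruhat_leP u v : bruhat_le s u v <-> connect bruhat_step u v.
Proof.
split=> [[a [b [_ <- rb <- sub_ab]]]|uv]; first exact: subword_connect.
have [b rb Eb] := reduced_word_exists v; rewrite -Eb in uv.
have [c sub_cb Ec] := connect_subword uv.
(* The subword [c] is thinned once more, as [bruhat_le] asks for a reduced one. *)
have [a [ra Ea sub_ac]] := reduced_subword c.
by exists a, b; split=> //; [rewrite Ea | apply: subseq_trans sub_cb].
Qed.

End CoxeterTheory.

Theorem proposition4p5 (W : finGroupType) (I : finType)
    (s : coxeterSystem W I) (f : {ffun W -> W}) (hf : biHecke s f)
    (u v : W) :
  bruhat_le s u v -> bruhat_le s (f u) (f v).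
Proof. by move/bruhat_leP/(biHecke_homo hf)/bruhat_leP. Qed.
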